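(* Let $G$ be a finitely generated group, equipped with a word metric with respect to a finite symmetric generating set, acting by isometries on a metric space $X$ with $\operatorname{asdim}_{AN}(X)<\infty$. Fix $x_0\in X$ and for $R>0$ let $W_R(x_0)=\{\gamma\in G: d(\gamma\cdot x_0,x_0)\le R\}$ (with the metric restricted from $G$). If there are constants $m,b,c>0$ such that for every $R>0$ the function $r\mapsto m r+bR+c$ is a $k$-dimensional control function of $W_R(x_0)$, then $$\operatorname{asdim}_{AN}(G)\le k+\operatorname{asdim}_{AN}(X).$$
   Context: A $k$-dimensional control function of a metric space $Z$ is a function $D\colon\mathbb R_+\to\mathbb R_+$ such that for every $r>0$ there are families $\mathcal U_1,\dots,\mathcal U_{k+1}$ of subsets of $Z$ covering $Z$, each $r$-disjoint (points in different members of the same family at distance $\ge r$), with members of diameter $\le D(r)$. $\operatorname{asdim}_{AN}(Z)\le n$ iff $Z$ has an $n$-dimensional control function of the form $r\mapsto cr+b$ with $b,c\ge0$; $\operatorname{asdim}_{AN}(Z)$ is the least such $n$. *)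

(* Defs.v *)
From Stdlib Require Import Reals List.
Open Scope R_scope.
Set Implicit Arguments.

Record Group := {
  gcar :> Type;
  gmul : gcar -> gcar -> gcar;
  gone : gcar;
  ginv : gcar -> gcar;
  gmulA : forall x y z, gmul x (gmul y z) = gmul (gmul x y) z;
  gmul1l : forall x, gmul gone x = x;
  gmulVl : forall x, gmul (ginv x) x = gone
}.

Fixpoint word_prod (G : Group) (w : list G) : G :=
  match w with
  | nil => gone G
  | s :: w' => gmul G s (word_prod G w')
  end.

Definition word_rep {G : Group} (S : list G) (g : G) (n : nat) : Prop :=
  exists w : list G, length w = n /\ (forall s, In s w -> In s S) /\ word_prod G w = g.

Definition finite_symmetric_generating {G : Group} (S : list G) : Prop :=
  (forall s, In s S -> In (ginv G s) S) /\ (forall g : G, exists n, word_rep S g n).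

Definition is_word_metric {G : Group} (S : list G) (dG : G -> G -> R) : Prop :=
  forall g h : G, exists n : nat,
    dG g h = INR n /\ word_rep S (gmul G (ginv G g) h) n /\
    (forall m, word_rep S (gmul G (ginv G g) h) m -> (n <= m)%nat).

Definition is_metric (X : Type) (d : X -> X -> R) : Prop :=
  (forall x y, 0 <= d x y) /\ (forall x y, d x y = 0 <-> x = y) /\
  (forall x y, d x y = d y x) /\ (forall x y z, d x z <= d x y + d y z).

Definition isometric_action (G : Group) (X : Type) (d : X -> X -> R)
    (act : G -> X -> X) : Prop :=
  (forall x, act (gone G) x = x) /\
  (forall g h x, act (gmul G g h) x = act g (act h x)) /\
  (forall g x y, d (act g x) (act g y) = d x y).

(* k-dimensional control function of the metric space Z (a subset of a type T
   carrying the restricted metric d).  Families are predicates on subsets;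
   family i (for i <= k) is U i. *)
Definition control_function (T : Type) (d : T -> T -> R) (Z : T -> Prop)
    (k : nat) (D : R -> R) : Prop :=
  (forall r, 0 <= r -> 0 <= D r) /\
  forall r, 0 < r ->
    exists U : nat -> (T -> Prop) -> Prop,
      (forall i A, (i <= k)%nat -> U i A -> forall x, A x -> Z x) /\
      (forall z, Z z -> exists i A, (i <= k)%nat /\ U i A /\ A z) /\
      (forall i A B, (i <= k)%nat -> U i A -> U i B -> A <> B ->
         forall x y, A x -> B y -> r <= d x y) /\
      (forall i A, (i <= k)%nat -> U i A -> forall x y, A x -> A y -> d x y <= D r).

Definition asdimAN_le (T : Type) (d : T -> T -> R) (Z : T -> Prop) (n : nat) : Prop :=
  exists c b : R, 0 <= b /\ 0 <= c /\ control_function d Z n (fun r => c * r + b).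

Definition setT_ (T : Type) : T -> Prop := fun _ => True.
Arguments setT_ : clear implicits.

(* Main.v *)
(** Let [f : G -> X] be the orbit map; it is Lipschitz, and preimages of sets of
    diameter [R] are translates of subsets of [W_R].  Cover [X] by families
    [U 0], ..., [U n], pairwise far apart, and use [k + n + 1] colours.  Colour
    [j] must avoid, for every [1 <= p <= n], the shell of points whose distance
    to [U p] is between [j * delta] and [(j + 1) * delta]: a point loses at most
    [n] colours, and a short-step chain that avoids the shells of colour [j] and
    meets a member [s] of [U p] stays close to [s].  The same device in the
    fibres (Kolmogorov's trick) gives each preimage of a member [k + n + 1]
    coloured sets such that a point loses at most [k] colours.  By the
    pigeonhole principle every point of [G] keeps a colour.  Taking the scale in
    the preimages of members of [U p] large compared with the components
    obtained from [U 0], ..., [U (p - 1)] keeps the components of every colour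
    bounded, and all bounds are affine in the initial scale. *)

Require Import Defs.
From Stdlib Require Import Reals List Lra Lia Classical IndefiniteDescription.
From Stdlib Require Import FunctionalExtensionality PropExtensionality.
Open Scope R_scope.
Set Implicit Arguments.

(** * Pseudometrics *)

Definition is_pseudometric (T : Type) (d : T -> T -> R) : Prop :=
  (forall x y, 0 <= d x y) /\ (forall x, d x x = 0) /\
  (forall x y, d x y = d y x) /\ (forall x y z, d x z <= d x y + d y z).

Lemma metric_pseudometric (T : Type) (d : T -> T -> R) :
  is_metric d -> is_pseudometric d.
Proof.
  intros [H0 [H1 [H2 H3]]]; repeat split; auto.
  intros x; now apply H1.
Qed.

(** * Chains *)

(** For a pseudometric the classes of this relation are the [r]-components of [A], and
    [chain_bounded] bounds their diameters. Steps are strictly shorter than [r], so that distinct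
    components are at distance at least [r]. *)
Inductive chain (T : Type) (d : T -> T -> R) (A : T -> Prop) (r : R) (x : T) :
    T -> Prop :=
| chain_refl : A x -> chain d A r x x
| chain_step y z : chain d A r x y -> A z -> d y z < r -> chain d A r x z.

Definition chain_bounded (T : Type) (d : T -> T -> R) (A : T -> Prop) (r M : R) :
    Prop :=
  forall x y, chain d A r x y -> d x y <= M.

Lemma chain_in_r (T : Type) (d : T -> T -> R) (A : T -> Prop) (r : R) x y :
  chain d A r x y -> A y.
Proof. now intros []. Qed.

Lemma chain_in_l (T : Type) (d : T -> T -> R) (A : T -> Prop) (r : R) x y :
  chain d A r x y -> A x.
Proof. induction 1; auto. Qed.

Lemma chain_trans (T : Type) (d : T -> T -> R) (A : T -> Prop) (r : R) x y z :
  chain d A r x y -> chain d A r y z -> chain d A r x z.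
Proof. intros Hxy Hyz; induction Hyz; eauto using chain_step. Qed.

Lemma chain_sym (T : Type) (d : T -> T -> R) (A : T -> Prop) (r : R) x y :
  is_pseudometric d -> chain d A r x y -> chain d A r y x.
Proof.
  intros [_ [_ [Hsym _]]]; induction 1 as [|y z Hxy IH Az Hyz].
  - now apply chain_refl.
  - apply chain_trans with y; auto.
    apply chain_step with z; [now apply chain_refl | | now rewrite Hsym].
    eapply chain_in_r; eauto.
Qed.

Lemma chain_sub (T : Type) (d : T -> T -> R) (A B : T -> Prop) (r : R) x y :
  (forall z, A z -> B z) -> chain d A r x y -> chain d B r x y.
Proof. intros HAB; induction 1; eauto using chain_refl, chain_step. Qed.

Lemma chain_invariant (T : Type) (d : T -> T -> R) (A P : T -> Prop) (r : R) x y :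
  P x -> (forall u v, P u -> A v -> d u v < r -> P v) ->
  chain d A r x y -> chain d (fun z => A z /\ P z) r x y.
Proof.
  intros Px HP; induction 1 as [|y z Hxy IH Az Hyz].
  - now apply chain_refl.
  - apply chain_step with y; auto.
    split; auto. apply HP with y; auto.
    now apply chain_in_r in IH.
Qed.

(** This dichotomy drives the inductions over the families: a chain that avoids the last family
    falls under the induction hypothesis, and otherwise both of its ends are reached from one point
    of that family. *)
Lemma chain_avoid_or_meet (T : Type) (d : T -> T -> R) (A B : T -> Prop) (r : R) x y :
  is_pseudometric d -> chain d A r x y ->
  chain d (fun z => A z /\ ~ B z) r x y \/
  exists w, B w /\ chain d A r w x /\ chain d A r w y.
Proof.
  intros Hd; induction 1 as [Ax|y z Hxy IH Az Hyz].
  - destruct (classic (B x)) as [Bx|nBx].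
    + right; exists x; auto using chain_refl.
    + left; now apply chain_refl.
  - destruct IH as [IH|[w [Bw [Hwx Hwy]]]].
    + destruct (classic (B z)) as [Bz|nBz].
      * right; exists z; split; [exact Bz|split; [|now apply chain_refl]].
        apply chain_sym; auto. eapply chain_step; eauto.
      * left; eapply chain_step; eauto.
    + right; exists w; eauto using chain_step.
Qed.

(** Contract the runs inside [A]. Between two consecutive visits to [B] there is at most a step, a
    run of diameter at most [M] and another step, so the visits form a chain in [B] with steps below
    [M + 2 * r]. The runs before the first visit and after the last one cost at most [M + r]
    each. *)
Lemma chain_bounded_union (T : Type) (d : T -> T -> R) (A B : T -> Prop) (r M D : R) :
  is_pseudometric d -> 0 < r -> 0 <= M -> 0 <= D ->
  chain_bounded d A r M -> chain_bounded d B (M + 2 * r) D ->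
  chain_bounded d (fun z => A z \/ B z) r (D + 2 * (M + r)).
Proof.
  intros [Hpos [Hrefl [Hsym Htri]]] Hr HM HD HA HB x y Hxy.
  (* Here [a] is the first visit to [B] and [l] the last one so far; [u] starts the current run in
     [A]. *)
  assert (Inv : chain d A r x y \/
    exists a l, d x a <= M + r /\ chain d B (M + 2 * r) a l /\
      (y = l \/ exists u, d l u < r /\ chain d A r u y)).
  { induction Hxy as [[Ax|Bx]|y z Hxy IH [Az|Bz] Hyz].
    - left; now apply chain_refl.
    - right; exists x, x; rewrite Hrefl; repeat split; [lra|now apply chain_refl|auto].
    - destruct IH as [IH|[a [l [Ha [Hal [->|[u [Hlu Huy]]]]]]]].
      + left; eapply chain_step; eauto.
      + right; exists a, l; repeat split; auto.
        right; exists z; split; [auto|now apply chain_refl].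
      + right; exists a, l; repeat split; auto.
        right; exists u; split; auto. eapply chain_step; eauto.
    - right; destruct IH as [IH|[a [l [Ha [Hal H]]]]].
      + exists z, z; repeat split; [|now apply chain_refl|auto].
        apply HA in IH. specialize (Htri x y z); lra.
      + exists a, z; repeat split; auto.
        apply chain_step with l; auto.
        destruct H as [->|[u [Hlu Huy]]]; [lra|].
        apply HA in Huy.
        pose proof (Htri l u z); pose proof (Htri u y z); lra. }
  destruct Inv as [H|[a [l [Ha [Hal H]]]]].
  - apply HA in H; lra.
  - apply HB in Hal.
    pose proof (Htri x a y); pose proof (Htri a l y).
    destruct H as [->|[u [Hlu Huy]]]; [rewrite Hrefl in *; lra|].
    apply HA in Huy. pose proof (Htri l u y); lra.
Qed.

(** * Control functions from components and from isometric maps *)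

Lemma control_function_of_chains (T : Type) (d : T -> T -> R) (Z : T -> Prop)
    (k : nat) (D : R -> R) :
  is_pseudometric d -> (forall r, 0 <= r -> 0 <= D r) ->
  (forall r, 0 < r -> exists E : nat -> T -> Prop,
     (forall i x, (i <= k)%nat -> E i x -> Z x) /\
     (forall z, Z z -> exists i, (i <= k)%nat /\ E i z) /\
     (forall i, (i <= k)%nat -> chain_bounded d (E i) r (D r))) ->
  control_function d Z k D.
Proof.
  intros Hd HD H; split; [exact HD|]. intros r Hr.
  destruct (H r Hr) as [E [HEZ [HZE HE]]].
  (* The members of family [i] are the [r]-components of [E i]; two of them with points closer than
     [r] are equal. *)
  exists (fun i A => exists x, A = chain d (E i) r x).
  split; [|split; [|split]].
  - intros i A Hi [x ->] y Hy. apply chain_in_r in Hy. eauto.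
  - intros z Hz. destruct (HZE z Hz) as [i [Hi Ei]].
    exists i, (chain d (E i) r z). repeat split; eauto using chain_refl.
  - intros i A B Hi [a ->] [b ->] Hne x y Hx Hy.
    destruct (Rle_lt_dec r (d x y)) as [|Hlt]; [assumption|].
    exfalso; apply Hne.
    assert (Hab : chain d (E i) r a b).
    { apply chain_trans with y; [|now apply chain_sym].
      apply chain_step with x; auto. eapply chain_in_r; eauto. }
    apply functional_extensionality; intros z.
    apply propositional_extensionality; split; intros Hz.
    + apply chain_trans with a; auto. now apply chain_sym.
    + now apply chain_trans with b.
  - intros i A Hi [a ->] x y Hx Hy.
    apply (HE i Hi). apply chain_trans with a; auto. now apply chain_sym.
Qed.

(** Serves to carry control from the sets [W_R] to fibres of the orbit map, along left translations.
    Distinct traces come from distinct members, so disjointness survives. *)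
Lemma control_function_isometric_preimage (T T' : Type) (d : T -> T -> R)
    (d' : T' -> T' -> R) (Z : T -> Prop) (Z' : T' -> Prop) (k : nat) (D : R -> R)
    (phi : T -> T') :
  (forall x y, d' (phi x) (phi y) = d x y) -> (forall x, Z x -> Z' (phi x)) ->
  control_function d' Z' k D -> control_function d Z k D.
Proof.
  intros Hphi HZ [HD H]; split; [exact HD|]. intros r Hr.
  destruct (H r Hr) as [U [_ [U2 [U3 U4]]]].
  exists (fun i A => exists B, U i B /\ A = (fun x => Z x /\ B (phi x))).
  split; [|split; [|split]].
  - now intros i A Hi [B [HB ->]] x [Hx _].
  - intros z Hz. destruct (U2 _ (HZ _ Hz)) as [i [B [Hi [HB HBz]]]].
    exists i, (fun x => Z x /\ B (phi x)); repeat split; eauto.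
  - intros i A1 A2 Hi [B1 [H1 ->]] [B2 [H2 ->]] Hne x y [_ Hx] [_ Hy].
    rewrite <- Hphi. apply (U3 i B1 B2); auto. intros ->; now apply Hne.
  - intros i A Hi [B [HB ->]] x y [_ Hx] [_ Hy].
    rewrite <- Hphi. apply (U4 i B); auto.
Qed.

(** * Colours lost by a point *)

(** Encodes that at most [k] colours fail [P]: each lost colour is blamed on one of [k] causes, and
    a cause accounts for at most one colour. Keeping the causes lets two such bounds be added
    without counting. *)
Definition all_but (k : nat) (P : nat -> Prop) : Prop :=
  exists lab : nat -> nat -> Prop,
    (forall j, ~ P j -> exists p, (p < k)%nat /\ lab p j) /\
    (forall p i j, lab p i -> lab p j -> i = j).

Lemma pigeonhole_rel (N : nat) (lab : nat -> nat -> Prop) :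
  (forall p i j, lab p i -> lab p j -> i = j) ->
  exists j, (j <= N)%nat /\ forall p, (p < N)%nat -> ~ lab p j.
Proof.
  intros Hinj. apply NNPP; intros Hn.
  (* The range condition sits under the existential, so that choice yields a total function; beyond
     [N] any value will do. *)
  assert (Hf : forall j, exists p, (j <= N)%nat -> (p < N)%nat /\ lab p j).
  { intros j. apply NNPP; intros H. apply Hn. exists j; split.
    - apply NNPP; intros Hj. apply H. exists O; tauto.
    - intros p Hp Hl. apply H. exists p; tauto. }
  apply functional_choice in Hf. destruct Hf as [f Hf].
  assert (Hlen : (length (map f (seq 0 (S N))) <= length (seq 0 N))%nat).
  { apply NoDup_incl_length.
    - apply NoDup_map_NoDup_ForallPairs; [|apply seq_NoDup].
      intros i j Hi Hj Hij. apply in_seq in Hi, Hj.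
      destruct (Hf i) as [_ Li]; [lia|]. destruct (Hf j) as [_ Lj]; [lia|].
      rewrite Hij in Li. eauto.
    - intros p Hp. apply in_map_iff in Hp. destruct Hp as [j [<- Hj]].
      apply in_seq in Hj. apply in_seq. destruct (Hf j); lia. }
  rewrite length_map, !length_seq in Hlen. lia.
Qed.

(** The causes of [Q] are shifted by [k] and placed after those of [P]: there are [k + n] causes for
    [k + n + 1] colours. *)
Lemma all_but_meet (k n : nat) (P Q : nat -> Prop) :
  all_but k P -> all_but n Q -> exists j, (j <= k + n)%nat /\ P j /\ Q j.
Proof.
  intros [lP [HP IP]] [lQ [HQ IQ]].
  destruct (@pigeonhole_rel (k + n) (fun p j =>
    ((p < k)%nat /\ lP p j) \/ ((k <= p)%nat /\ lQ (p - k)%nat j))) as [j [Hj H]].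
  { intros p i j [[H1 H2]|[H1 H2]] [[H3 H4]|[H3 H4]]; try lia; eauto. }
  exists j; split; [exact Hj|split]; apply NNPP; intros Hn.
  - destruct (HP j Hn) as [p [Hp Hl]]. apply (H p); [lia|auto].
  - destruct (HQ j Hn) as [p [Hp Hl]]. apply (H (k + p)%nat); [lia|].
    right; split; [lia|]. now replace (k + p - k)%nat with p by lia.
Qed.

(** * Shells *)

Definition thickening (T : Type) (d : T -> T -> R) (A : T -> Prop) (s : R) (y : T) :
    Prop :=
  exists z, A z /\ d y z <= s.

Definition near (T : Type) (d : T -> T -> R) (F : (T -> Prop) -> Prop) (s : R)
    (y : T) : Prop :=
  exists A, F A /\ thickening d A s y.

Definition in_shell (T : Type) (d : T -> T -> R) (F : (T -> Prop) -> Prop)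
    (delta : R) (j : nat) (y : T) : Prop :=
  near d F (INR (S j) * delta) y /\ ~ near d F (INR j * delta) y.

(* The family [U 0] has no shells: they would cost every point one more colour. *)
Definition off_shells (T : Type) (d : T -> T -> R) (U : nat -> (T -> Prop) -> Prop)
    (delta : R) (n j : nat) (y : T) : Prop :=
  forall p, (1 <= p <= n)%nat -> ~ in_shell d (U p) delta j y.

Definition separated (T : Type) (d : T -> T -> R) (F : (T -> Prop) -> Prop) (L : R) :
    Prop :=
  forall A B, F A -> F B -> A <> B -> forall x y, A x -> B y -> L <= d x y.

(** Closeness is monotone in the radius, and for [i < j] the outer radius of shell [i] is at most
    the inner radius of shell [j]. Hence one family costs a point at most one colour. *)
Lemma in_shell_inj (T : Type) (d : T -> T -> R) (F : (T -> Prop) -> Prop)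
    (delta : R) (i j : nat) (y : T) :
  0 <= delta -> in_shell d F delta i y -> in_shell d F delta j y -> i = j.
Proof.
  intros Hdelta.
  assert (Hlt : forall a b, (a < b)%nat ->
    in_shell d F delta a y -> ~ in_shell d F delta b y).
  { intros a b Hab [[A [FA [z [Az Hz]]]] _] [_ Hb]. apply Hb.
    exists A; split; auto. exists z; split; auto.
    apply Rle_trans with (1 := Hz). apply Rmult_le_compat_r; auto.
    apply le_INR; lia. }
  intros Hi Hj. destruct (Nat.lt_trichotomy i j) as [H|[H|H]]; auto.
  - now destruct (Hlt _ _ H Hi).
  - now destruct (Hlt _ _ H Hj).
Qed.

Lemma all_but_off_shells (T : Type) (d : T -> T -> R) (U : nat -> (T -> Prop) -> Prop)
    (delta : R) (n : nat) (y : T) :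
  0 <= delta -> all_but n (fun j => off_shells d U delta n j y).
Proof.
  (* Causes are counted from 0 and shells from 1, hence the successor. *)
  intros Hdelta. exists (fun p j => in_shell d (U (S p)) delta j y). split.
  - intros j Hj. apply not_all_ex_not in Hj. destruct Hj as [p Hp].
    apply imply_to_and in Hp. destruct Hp as [Hp H]. apply NNPP in H.
    exists (p - 1)%nat. replace (S (p - 1)) with p by lia. split; [lia|auto].
  - intros p i j. now apply in_shell_inj.
Qed.

Lemma separated_thickening_eq (T : Type) (d : T -> T -> R) (F : (T -> Prop) -> Prop)
    (L s s' : R) (A B : T -> Prop) (x y : T) :
  is_pseudometric d -> separated d F L -> F A -> F B ->
  thickening d A s x -> thickening d B s' y -> s + d x y + s' < L -> A = B.
Proof.
  intros [Hpos [Hrefl [Hsym Htri]]] HF FA FB [a [Aa Ha]] [b [Bb Hb]] HL.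
  apply NNPP; intros Hne. pose proof (HF A B FA FB Hne a b Aa Bb).
  pose proof (Htri a x b); pose proof (Htri x y b). rewrite (Hsym a x) in *; lra.
Qed.

(** The step brings [y] within [(j + 1) * delta] of [A]; being off the shell, [y] is then within
    [j * delta] of some member [B]. Since [j * delta + delta + j * delta] is at most the separation,
    [B] is [A]. For [p = 0] there is no shell, and [y] is instead assumed to lie in a member. *)
Lemma thickening_step (T : Type) (d : T -> T -> R) (U : nat -> (T -> Prop) -> Prop)
    (delta : R) (n N p j : nat) (A : T -> Prop) (x y : T) :
  is_pseudometric d -> 0 < delta -> (j <= N)%nat -> (p <= n)%nat ->
  separated d (U p) ((2 * INR N + 1) * delta) -> U p A ->
  off_shells d U delta n j y -> (p = 0%nat -> exists B, U 0%nat B /\ B y) ->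
  thickening d A (INR j * delta) x -> d x y < delta ->
  thickening d A (INR j * delta) y.
Proof.
  intros Hd Hdelta Hj Hp Hsep UA Hy Hy0 Hx Hxy.
  pose proof Hd as [Hpos [Hrefl [Hsym Htri]]].
  assert (HjN : INR j * delta <= INR N * delta).
  { apply Rmult_le_compat_r; [lra|]. now apply le_INR. }
  assert (Hj0 : 0 <= INR j * delta) by (apply Rmult_le_pos; [apply pos_INR|lra]).
  assert (HB : exists B, U p B /\ thickening d B (INR j * delta) y).
  { destruct p as [|p].
    - destruct (Hy0 eq_refl) as [B [UB By]]. exists B; split; auto.
      exists y; rewrite Hrefl; auto.
    - apply NNPP; intros Hn. apply (Hy (S p)); [lia|]. split; [|exact Hn].
      exists A; split; auto. destruct Hx as [z [Az Hz]]. exists z; split; auto.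
      rewrite S_INR. specialize (Htri y x z). rewrite (Hsym y x) in Htri. lra. }
  destruct HB as [B [UB HB]].
  assert (A = B) as ->; [|exact HB].
  apply (separated_thickening_eq (x := x) (y := y) Hd Hsep UA UB Hx HB). lra.
Qed.

(** * Kolmogorov's trick: many colours from few families *)

Definition below (T : Type) (U : nat -> (T -> Prop) -> Prop) (p : nat) (y : T) : Prop :=
  exists q A, (q < p)%nat /\ U q A /\ A y.

(** Induction on [p]: a chain that meets a member [A] of the highest family stays within [j * r] of
    [A], and any other chain lives in the lower families. The bound does not grow with [p]. *)
Lemma off_shells_bounded (T : Type) (d : T -> T -> R) (U : nat -> (T -> Prop) -> Prop)
    (r M : R) (k N j : nat) :
  is_pseudometric d -> 0 < r -> (j <= N)%nat ->
  (forall p, (p <= k)%nat -> separated d (U p) ((2 * INR N + 1) * r)) ->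
  (forall p A, (p <= k)%nat -> U p A -> forall x y, A x -> A y -> d x y <= M) ->
  forall p, (p <= S k)%nat ->
  chain_bounded d (fun y => below U p y /\ off_shells d U r k j y) r
    (M + 2 * INR N * r).
Proof.
  intros Hd Hr Hj Hsep HM.
  pose proof Hd as [Hpos [Hrefl [Hsym Htri]]].
  assert (HjN : INR j * r <= INR N * r).
  { apply Rmult_le_compat_r; [lra|]. now apply le_INR. }
  induction p as [|p IH]; intros Hp x y Hxy.
  { apply chain_in_l in Hxy. destruct Hxy as [[q [A [Hq _]]] _]; lia. }
  apply (chain_avoid_or_meet (fun y => exists A, U p A /\ A y)) in Hxy; auto.
  destruct Hxy as [Hxy|[w [[A [UA Aw]] [Hwx Hwy]]]].
  - apply IH; [lia|]. revert Hxy; apply chain_sub.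
    intros z [[[q [A [Hq [UA Az]]]] Hz] Hn]. split; auto.
    exists q, A; repeat split; auto.
    assert (q <> p) by (intros ->; eauto). lia.
  - assert (Hnear : forall v, chain d (fun y => below U (S p) y /\ off_shells d U r k j y) r w v ->
      thickening d A (INR j * r) v).
    { intros v Hv. apply (chain_invariant (thickening d A (INR j * r))) in Hv.
      - apply chain_in_r in Hv; tauto.
      - exists w; split; auto. rewrite Hrefl. apply Rmult_le_pos; [apply pos_INR|lra].
      - intros u z Hu [[q [B [Hq [UB Bz]]]] Hz] Huz.
        apply (@thickening_step T d U r k N p j A u z); auto; try lia.
        + apply Hsep; lia.
        (* For [p = 0] the chain lives below 1, so each of its points lies in a member of [U 0], as
           the case without shells demands. *)
        + intros ->. exists B. now replace 0%nat with q by lia. }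
    destruct (Hnear x Hwx) as [a [Aa Ha]]. destruct (Hnear y Hwy) as [b [Ab Hb]].
    pose proof (HM p A ltac:(lia) UA a b Aa Ab).
    pose proof (Htri x a y); pose proof (Htri a b y). rewrite (Hsym b y) in *; lra.
Qed.

(** Apply the control function at scale [(2 * N + 1) * r], which leaves room for [N + 1] shells
    around each member. A point lies in some member, so only shells cost it colours, one for each of
    the families [1] to [k]. *)
Lemma control_function_colours (T : Type) (d : T -> T -> R) (Z : T -> Prop)
    (k N : nat) (D : R -> R) (r : R) :
  is_pseudometric d -> control_function d Z k D -> 0 < r ->
  exists E : nat -> T -> Prop,
    (forall j, (j <= N)%nat ->
       chain_bounded d (E j) r (D ((2 * INR N + 1) * r) + 2 * INR N * r)) /\
    (forall z, Z z -> all_but k (fun j => E j z)).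
Proof.
  intros Hd [_ H] Hr.
  assert (HL : 0 < (2 * INR N + 1) * r).
  { apply Rmult_lt_0_compat; [|lra]. pose proof (pos_INR N); lra. }
  destruct (H _ HL) as [U [_ [U2 [U3 U4]]]].
  exists (fun j y => below U (S k) y /\ off_shells d U r k j y). split.
  - intros j Hj. apply off_shells_bounded; auto.
    intros p Hp A B UA UB; now apply (U3 p).
  - intros z Hz. destruct (U2 z Hz) as [i [A [Hi [UA Az]]]].
    destruct (@all_but_off_shells T d U r k z) as [lab [H1 H2]]; [lra|].
    exists lab; split; auto. intros j Hj. apply H1. intros Ho. apply Hj.
    split; auto. exists i, A; repeat split; auto; lia.
Qed.

(** * A Hurewicz theorem *)

(** [V q A j] is meant as colour [j] in the fibre over [A]. The cutoff [p] exists for the induction;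
    the actual colours are those with [p = n + 1]. *)
Definition fibered_colour (T X : Type) (dX : X -> X -> R) (f : T -> X)
    (U : nat -> (X -> Prop) -> Prop) (V : nat -> (X -> Prop) -> nat -> T -> Prop)
    (delta : R) (n j p : nat) (t : T) : Prop :=
  off_shells dX U delta n j (f t) /\
  exists q A, (q < p)%nat /\ U q A /\ A (f t) /\ V q A j t.

(** Over a neighbourhood of a single member [A] of [U p], the colour is the union of the part from
    lower families, bounded by [M p], and of [V p A j], which is bounded at the larger scale
    [M p + 2 * r]. This is the situation of [chain_bounded_union], whence the recursion for [M]. *)
Lemma fibered_colour_bounded (T X : Type) (d : T -> T -> R) (dX : X -> X -> R)
    (f : T -> X) (U : nat -> (X -> Prop) -> Prop)
    (V : nat -> (X -> Prop) -> nat -> T -> Prop) (r delta : R) (n N j : nat)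
    (M K : nat -> R) :
  is_pseudometric d -> is_pseudometric dX -> 0 < r -> 0 < delta -> (j <= N)%nat ->
  (forall s t, d s t < r -> dX (f s) (f t) < delta) ->
  (forall p, (p <= n)%nat -> separated dX (U p) ((2 * INR N + 1) * delta)) ->
  (forall p, 0 <= M p) -> (forall p, 0 <= K p) ->
  (forall p, K p + 2 * (M p + r) <= M (S p)) ->
  (forall p A, (p <= n)%nat -> U p A ->
     chain_bounded d (V p A j) (M p + 2 * r) (K p)) ->
  forall p, (p <= S n)%nat ->
  chain_bounded d (fibered_colour dX f U V delta n j p) r (M p).
Proof.
  intros Hd HdX Hr Hdelta Hj Hf Hsep HM HK HMK HV.
  pose proof HdX as [Hpos [Hrefl [Hsym Htri]]].
  assert (HjN : INR j * delta <= INR N * delta).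
  { apply Rmult_le_compat_r; [lra|]. now apply le_INR. }
  assert (Hj0 : 0 <= INR j * delta) by (apply Rmult_le_pos; [apply pos_INR|lra]).
  induction p as [|p IH]; intros Hp x y Hxy.
  { apply chain_in_l in Hxy. destruct Hxy as [_ [q [A [Hq _]]]]; lia. }
  assert (Hp' : (p <= n)%nat) by lia.
  specialize (IH ltac:(lia)).
  pose proof (HK p); pose proof (HM p); pose proof (HMK p).
  apply (chain_avoid_or_meet (fun t => exists A, U p A /\ A (f t) /\ V p A j t)) in Hxy;
    auto.
  destruct Hxy as [Hxy|[w [[A [UA [Aw _]]] [Hwx Hwy]]]].
  - apply Rle_trans with (M p); [|lra].
    apply IH. revert Hxy; apply chain_sub.
    intros z [[Hz [q [A [Hq [UA [Az Vz]]]]]] Hn]. split; auto.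
    exists q, A; repeat split; auto.
    assert (q <> p) by (intros ->; eauto). lia.
  - set (P := fun t => thickening dX A (INR j * delta) (f t)).
    (* A step in [T] moves the image by less than [delta], so [thickening_step] keeps the chain over
       the neighbourhood of [A]. *)
    assert (Hnear : forall v, chain d (fibered_colour dX f U V delta n j (S p)) r w v ->
      chain d (fun t => fibered_colour dX f U V delta n j (S p) t /\ P t) r w v).
    { intros v. apply chain_invariant.
      - exists (f w); split; auto. now rewrite Hrefl.
      - intros u z Hu [Hz [q [B [Hq [UB [Bz _]]]]]] Huz.
        apply (@thickening_step X dX U delta n N p j A (f u) (f z)); auto.
        intros ->. exists B. now replace 0%nat with q by lia. }
    apply Hnear in Hwx, Hwy. apply chain_sym in Hwx; auto.
    pose proof (chain_trans Hwx Hwy) as Hxy.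
    apply Rle_trans with (K p + 2 * (M p + r)); [|lra].
    eapply (chain_bounded_union Hd Hr (HM p) (HK p) IH (HV p A Hp' UA)).
    revert Hxy; apply chain_sub.
    intros z [[Hz [q [B [Hq [UB [Bz Vz]]]]]] Pz].
    destruct (Nat.eq_dec q p) as [->|Hqp].
    (* The image of [z] lies in [B] and near [A], two members of the separated family [U p]. *)
    + right. replace A with B; auto.
      apply (separated_thickening_eq (s := 0) (s' := INR j * delta)
               (x := f z) (y := f z) HdX (Hsep p Hp')); auto.
      * exists (f z); split; auto. rewrite Hrefl; lra.
      * rewrite Hrefl. lra.
    + left. split; auto. exists q, B; repeat split; auto; lia.
Qed.

Fixpoint affine_iter (a w : R) (p : nat) : R :=
  match p with
  | O => 0
  | S p' => a * affine_iter a w p' + w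
  end.

(** Linearity in [w] makes the final bound affine in the scale, since [w] will be affine in it while
    the factor is constant. *)
Lemma affine_iter_scale (a w : R) (p : nat) :
  affine_iter a w p = affine_iter a 1 p * w.
Proof. induction p as [|p IH]; simpl; [ring|rewrite IH; ring]. Qed.

Lemma affine_iter_nonneg (a w : R) (p : nat) :
  0 <= a -> 0 <= w -> 0 <= affine_iter a w p.
Proof.
  intros; induction p; simpl; [lra|].
  apply Rplus_le_le_0_compat; auto using Rmult_le_pos. Qed.

Theorem asdimAN_le_fibers (T X : Type) (d : T -> T -> R) (dX : X -> X -> R)
    (f : T -> X) (k n : nat) (lam m b c : R) :
  is_pseudometric d -> is_pseudometric dX -> 0 < lam ->
  (forall s t, dX (f s) (f t) <= lam * d s t) ->
  0 <= m -> 0 <= b -> 0 <= c ->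
  (forall Rr A, 0 < Rr -> (forall x y, A x -> A y -> dX x y <= Rr) ->
     control_function d (fun t => A (f t)) k (fun r => m * r + b * Rr + c)) ->
  asdimAN_le dX (setT_ X) n -> asdimAN_le d (setT_ T) (k + n).
Proof.
  intros Hd HdX Hlam Hf Hm Hb Hc Hfib [cX [bX [HbX [HcX [_ HX]]]]].
  set (N := (k + n)%nat). set (h := 2 * INR N + 1).
  assert (Hh : 1 <= h) by (pose proof (pos_INR N); unfold h; lra).
  (* At scale [s], [control_function_colours] bounds the colours of a fibre over a set of diameter
     [Rr] by [alpha * s + b * Rr + c]. *)
  set (alpha := m * h + 2 * INR N).
  assert (Halpha : 0 <= alpha).
  { pose proof (pos_INR N). unfold alpha.
    assert (0 <= m * h) by (apply Rmult_le_pos; lra). lra. }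
  (* At separation [h * lam * r], the members in [X] have diameter at most [u * r + bX]. The extra 1
     in [v] makes [Rr] positive. *)
  set (u := cX * (h * lam)).
  assert (Hu : 0 <= u) by (unfold u; repeat apply Rmult_le_pos; lra).
  set (v := bX + 1).
  set (g := affine_iter (alpha + 2) 1 (S n)).
  assert (Hg : 0 <= g) by (apply affine_iter_nonneg; lra).
  assert (Hbu : 0 <= b * u) by now apply Rmult_le_pos.
  assert (Hbv : 0 <= b * v) by (apply Rmult_le_pos; unfold v; lra).
  assert (Hc1 : 0 <= g * (2 * alpha + b * u + 2)) by (apply Rmult_le_pos; lra).
  assert (Hb1 : 0 <= g * (b * v + c)) by (apply Rmult_le_pos; lra).
  exists (g * (2 * alpha + b * u + 2)), (g * (b * v + c)).
  split; [exact Hb1|split; [exact Hc1|]].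
  apply control_function_of_chains; auto.
  { intros r Hr. apply Rplus_le_le_0_compat; auto using Rmult_le_pos. }
  intros r Hr.
  set (delta := lam * r).
  assert (Hdelta : 0 < delta) by now apply Rmult_lt_0_compat.
  assert (HL : 0 < h * delta) by (apply Rmult_lt_0_compat; lra).
  destruct (HX _ HL) as [U [_ [U2 [U3 U4]]]].
  (* Chosen so that [K p + 2 * (M p + r)] equals [(alpha + 2) * M p + w]. *)
  set (w := (2 * alpha + b * u + 2) * r + (b * v + c)).
  assert (Hw : 0 <= w).
  { unfold w. apply Rplus_le_le_0_compat; [apply Rmult_le_pos|]; lra. }
  set (M := affine_iter (alpha + 2) w).
  assert (HM : forall p, 0 <= M p) by (intros p; apply affine_iter_nonneg; lra).
  set (Rr := u * r + v).
  assert (HRr : 0 < Rr).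
  { assert (0 <= u * r) by (apply Rmult_le_pos; lra). unfold Rr, v; lra. }
  set (K := fun p => alpha * (M p + 2 * r) + b * Rr + c).
  (* Indexing by pairs allows a single use of choice; pairs outside the families receive a dummy
     colouring. *)
  assert (HV : forall pA : nat * (X -> Prop), exists E : nat -> T -> Prop,
    (fst pA <= n)%nat -> U (fst pA) (snd pA) ->
    (forall j, (j <= N)%nat -> chain_bounded d (E j) (M (fst pA) + 2 * r) (K (fst pA))) /\
    (forall t, snd pA (f t) -> all_but k (fun j => E j t))).
  { intros [p A]; simpl.
    destruct (classic ((p <= n)%nat /\ U p A)) as [[Hp UA]|Hn];
      [|exists (fun _ _ => True); tauto].
    assert (Hs : 0 < M p + 2 * r) by (pose proof (HM p); lra).
    assert (HA : forall x y, A x -> A y -> dX x y <= Rr).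
    { intros x y Ax Ay. pose proof (U4 p A Hp UA x y Ax Ay).
      replace Rr with (cX * (h * delta) + bX + 1); [lra|].
      unfold Rr, u, v, delta; ring. }
    destruct (control_function_colours N Hd (Hfib Rr A HRr HA) Hs) as [E [E1 E2]].
    exists E; intros _ _; split; [|exact E2].
    intros j Hj.
    replace (K p) with (m * ((2 * INR N + 1) * (M p + 2 * r)) + b * Rr + c
                        + 2 * INR N * (M p + 2 * r)); [auto|].
    unfold K, alpha, h; ring. }
  apply functional_choice in HV. destruct HV as [V HV].
  set (V' := fun p A => V (p, A)).
  exists (fun j => fibered_colour dX f U V' delta n j (S n)).
  split; [now unfold setT_|split].
  - intros t _. destruct (U2 (f t) I) as [p [A [Hp [UA At]]]].
    destruct (HV (p, A) Hp UA) as [_ Hall].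
    (* The fibre costs [t] at most [k] colours and the shells at most [n], out of [k + n + 1]. *)
    destruct (all_but_meet (Hall t At)
      (@all_but_off_shells X dX U delta n (f t) (Rlt_le _ _ Hdelta)))
      as [j [Hj [HVj Hoff]]].
    exists j; repeat split; auto.
    exists p, A; repeat split; auto; lia.
  - intros j Hj.
    replace (g * (2 * alpha + b * u + 2) * r + g * (b * v + c)) with (M (S n)).
    2:{ unfold M. rewrite affine_iter_scale. fold g. unfold w; ring. }
    apply fibered_colour_bounded with (N := N) (K := K); auto.
    + intros s t Hst. apply Rle_lt_trans with (1 := Hf s t).
      now apply Rmult_lt_compat_l.
    + intros p Hp A B UA UB; now apply (U3 p).
    + intros p. unfold K. pose proof (HM p).
      assert (0 <= alpha * (M p + 2 * r)) by (apply Rmult_le_pos; lra).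
      assert (0 <= b * Rr) by (apply Rmult_le_pos; lra). lra.
    + intros p. right. unfold K, M, Rr. simpl. fold M. unfold w; ring.
    + intros p A Hp UA. destruct (HV (p, A) Hp UA) as [H _]. now apply H.
Qed.

(** * Word metrics *)

(** Only left laws are given: insert the unit as the product of the inverse of [ginv G x] with
    [ginv G x]. *)
Lemma gmulVr (G : Group) (x : G) : gmul G x (ginv G x) = gone G.
Proof.
  rewrite <- (gmul1l G (gmul G x (ginv G x))).
  rewrite <- (gmulVl G (ginv G x)) at 1.
  rewrite <- gmulA, (gmulA G (ginv G x) x), gmulVl, gmul1l. apply gmulVl.
Qed.

Lemma gmul1r (G : Group) (x : G) : gmul G x (gone G) = x.
Proof. now rewrite <- (gmulVl G x), gmulA, gmulVr, gmul1l. Qed.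

Lemma gmulKV (G : Group) (x y : G) : gmul G (ginv G x) (gmul G x y) = y.
Proof. now rewrite gmulA, gmulVl, gmul1l. Qed.

Lemma gmulVK (G : Group) (x y : G) : gmul G x (gmul G (ginv G x) y) = y.
Proof. now rewrite gmulA, gmulVr, gmul1l. Qed.

Lemma ginv_unique (G : Group) (x y : G) : gmul G x y = gone G -> ginv G x = y.
Proof. intros H. now rewrite <- (gmulKV G x y), H, gmul1r. Qed.

Lemma ginvM (G : Group) (x y : G) :
  ginv G (gmul G x y) = gmul G (ginv G y) (ginv G x).
Proof.
  apply ginv_unique. now rewrite <- gmulA, gmulVK, gmulVr.
Qed.

Lemma ginvK (G : Group) (x : G) : ginv G (ginv G x) = x.
Proof. apply ginv_unique, gmulVl. Qed.

Lemma word_prod_app (G : Group) (v w : list G) :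
  word_prod G (v ++ w) = gmul G (word_prod G v) (word_prod G w).
Proof.
  induction v as [|s v IH]; simpl; [now rewrite gmul1l|].
  now rewrite IH, gmulA.
Qed.

Lemma word_rep_mul (G : Group) (S : list G) (g h : G) (p q : nat) :
  word_rep S g p -> word_rep S h q -> word_rep S (gmul G g h) (p + q).
Proof.
  intros [v [<- [Hv <-]]] [w [<- [Hw <-]]]. exists (v ++ w).
  rewrite length_app, word_prod_app; repeat split; auto.
  intros s Hs. apply in_app_iff in Hs. destruct Hs; auto.
Qed.

Lemma word_rep_inv (G : Group) (S : list G) (g : G) (p : nat) :
  (forall s, In s S -> In (ginv G s) S) -> word_rep S g p -> word_rep S (ginv G g) p.
Proof.
  intros HS [w [<- [Hw <-]]]. exists (rev (map (ginv G) w)).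
  rewrite length_rev, length_map; repeat split.
  - intros s Hs. apply in_rev in Hs. apply in_map_iff in Hs.
    destruct Hs as [t [<- Ht]]; auto.
  - clear Hw. induction w as [|s w IH]; simpl; [apply eq_sym, ginv_unique, gmul1l|].
    now rewrite word_prod_app, IH, ginvM; simpl; rewrite gmul1r.
Qed.

Lemma word_metric_le (G : Group) (S : list G) (dG : G -> G -> R) (g h : G) (p : nat) :
  is_word_metric S dG -> word_rep S (gmul G (ginv G g) h) p -> dG g h <= INR p.
Proof.
  intros H Hp. destruct (H g h) as [q [-> [_ Hq]]]. apply le_INR; auto.
Qed.

(** Symmetry comes from inverting a shortest word, the triangle inequality from concatenating
    two. *)
Lemma word_metric_pseudometric (G : Group) (S : list G) (dG : G -> G -> R) :
  (forall s, In s S -> In (ginv G s) S) -> is_word_metric S dG -> is_pseudometric dG.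
Proof.
  intros HS H.
  assert (Hpos : forall x y, 0 <= dG x y).
  { intros x y. destruct (H x y) as [p [-> _]]. apply pos_INR. }
  assert (Hsym : forall x y, dG x y <= dG y x).
  { intros x y. destruct (H y x) as [p [-> [Hp _]]].
    apply (word_metric_le _ _ H). apply word_rep_inv in Hp; auto.
    now rewrite ginvM, ginvK in Hp. }
  repeat split; auto.
  - intros x. apply Rle_antisym; auto. change 0 with (INR 0).
    apply (word_metric_le _ _ H). rewrite gmulVl. exists nil; simpl; tauto.
  - intros x y. now apply Rle_antisym.
  - intros x y z. destruct (H x y) as [p [-> [Hp _]]].
    destruct (H y z) as [q [-> [Hq _]]]. rewrite <- plus_INR.
    apply (word_metric_le _ _ H).
    rewrite <- (gmulVK G y z), (gmulA G (ginv G x)). now apply word_rep_mul.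
Qed.

Lemma word_metric_left_invariant (G : Group) (S : list G) (dG : G -> G -> R) (a g h : G) :
  is_word_metric S dG -> dG (gmul G a g) (gmul G a h) = dG g h.
Proof.
  intros H.
  assert (E : gmul G (ginv G (gmul G a g)) (gmul G a h) = gmul G (ginv G g) h).
  { now rewrite ginvM, <- gmulA, gmulKV. }
  apply Rle_antisym.
  - destruct (H g h) as [p [-> [Hp _]]]. apply (word_metric_le _ _ H). now rewrite E.
  - destruct (H (gmul G a g) (gmul G a h)) as [p [-> [Hp _]]].
    apply (word_metric_le _ _ H). now rewrite <- E.
Qed.

(** * The orbit map *)

Lemma orbit_dist (G : Group) (X : Type) (dX : X -> X -> R) (act : G -> X -> X)
    (x0 : X) (g h : G) :
  isometric_action G dX act ->
  dX (act (gmul G (ginv G g) h) x0) x0 = dX (act h x0) (act g x0).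
Proof.
  intros [A1 [A2 A3]].
  now rewrite <- (A3 g), <- A2, gmulVK.
Qed.

(** The base value 1 keeps this Lipschitz constant positive even when every generator fixes [x0]. *)
Fixpoint max_displacement (G : Group) (X : Type) (dX : X -> X -> R)
    (act : G -> X -> X) (x0 : X) (S : list G) : R :=
  match S with
  | nil => 1
  | s :: S' => Rmax (dX (act s x0) x0) (max_displacement G dX act x0 S')
  end.

Lemma max_displacement_ge1 (G : Group) (X : Type) (dX : X -> X -> R)
    (act : G -> X -> X) (x0 : X) (S : list G) :
  1 <= max_displacement G dX act x0 S.
Proof.
  induction S as [|s S IH]; simpl; [lra|].
  apply Rle_trans with (1 := IH), Rmax_r.
Qed.

Lemma max_displacement_spec (G : Group) (X : Type) (dX : X -> X -> R)
    (act : G -> X -> X) (x0 : X) (S : list G) (s : G) :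
  In s S -> dX (act s x0) x0 <= max_displacement G dX act x0 S.
Proof.
  induction S as [|t S IH]; simpl; [tauto|]. intros [->|Hs]; [apply Rmax_l|].
  apply Rle_trans with (1 := IH Hs), Rmax_r.
Qed.

(** By invariance only the displacement of [x0] by a shortest word for [ginv G g] times [h] matters,
    and each letter adds at most the largest displacement of a generator. *)
Lemma orbit_map_lipschitz (G : Group) (S : list G) (dG : G -> G -> R) (X : Type)
    (dX : X -> X -> R) (act : G -> X -> X) (x0 : X) (g h : G) :
  is_word_metric S dG -> is_pseudometric dX -> isometric_action G dX act ->
  dX (act g x0) (act h x0) <= max_displacement G dX act x0 S * dG g h.
Proof.
  intros H [Hpos [Hrefl [Hsym Htri]]] Hact.
  pose proof Hact as [A1 [A2 A3]].
  destruct (H g h) as [p [-> [[w [<- [Hw Hwp]]] _]]].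
  rewrite Hsym, <- (orbit_dist x0 g h Hact), <- Hwp. clear Hwp g h.
  induction w as [|s w IH].
  - simpl. rewrite A1, Hrefl. lra.
  - change (length (s :: w)) with (Datatypes.S (length w)).
    rewrite S_INR. cbn [word_prod]. rewrite A2.
    pose proof (Htri (act s (act (word_prod G w) x0)) (act s x0) x0) as Ht.
    rewrite A3 in Ht.
    pose proof (max_displacement_spec G dX act x0 S s (Hw s (or_introl eq_refl))).
    pose proof (IH (fun t Ht => Hw t (or_intror Ht))). lra.
Qed.

Unset Implicit Arguments.

Theorem mainTheorem19 (G : Group) (S : list G) (dG : G -> G -> R)
  (X : Type) (dX : X -> X -> R) (act : G -> X -> X) (x0 : X) (k : nat)
  (m b c : R) :
  finite_symmetric_generating S ->
  is_word_metric S dG ->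
  is_metric dX ->
  isometric_action G dX act ->
  (exists n : nat, asdimAN_le dX (setT_ X) n) ->
  0 < m -> 0 < b -> 0 < c ->
  (forall Rr : R, 0 < Rr ->
     control_function dG (fun g : G => dX (act g x0) x0 <= Rr) k
       (fun r => m * r + b * Rr + c)) ->
  forall n : nat, asdimAN_le dX (setT_ X) n -> asdimAN_le dG (setT_ G) (k + n).
Proof.
  intros [HS _] HG HX Hact _ Hm Hb Hc HW n.
  apply metric_pseudometric in HX.
  apply asdimAN_le_fibers with (f := fun g => act g x0) (m := m) (b := b) (c := c)
    (lam := max_displacement G dX act x0 S); try lra; auto.
  - now apply word_metric_pseudometric with S.
  - pose proof (max_displacement_ge1 G dX act x0 S); lra.
  - intros g h. now apply orbit_map_lipschitz.
  - intros Rr A HRr HA.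
    (* Any element of the fibre over [A] serves as base point; for an empty fibre the unit does. *)
    assert (Hg : exists g0, forall g, A (act g x0) -> dX (act g x0) (act g0 x0) <= Rr).
    { destruct (classic (exists g0, A (act g0 x0))) as [[g0 Hg0]|Hn].
      - exists g0; auto.
      - exists (gone G). intros g Hg; now destruct Hn; exists g. }
    destruct Hg as [g0 Hg0].
    (* Left translation by the inverse of [g0] is an isometry that carries the fibre into [W_R]. *)
    apply (control_function_isometric_preimage) with (3 := HW Rr HRr)
      (phi := gmul G (ginv G g0)).
    + intros g h. now apply word_metric_left_invariant with S.
    + intros g Hg. rewrite orbit_dist; auto.
Qed.
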